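(* Let $\epsilon_L > 0$ be a real number and let $(\epsilon_i)_{i=1}^\infty$ be a sequence of positive real numbers with $\sum_{i=1}^\infty \epsilon_i^2 = \infty$. Then there exists a Bing tree of functions $\{f_\sigma : [c_\sigma,d_\sigma]\to[0,1]\}$, indexed by all finite binary strings $\sigma$, with daughter clasp points $a_\sigma, b_\sigma$, that shrinks and is such that: (1) for every finite binary string $\sigma$, $|d_\sigma - c_\sigma| < 1 + \epsilon_L$; and (2) for every $i \ge 1$ and every binary string $\sigma$ of length $|\sigma| = i$, $|a_\sigma - c_\sigma| < \epsilon_i$ and $|d_\sigma - b_\sigma| < \epsilon_i$.
   Context: Finite binary strings $\sigma$ (including the empty string $\varnothing$) index the nodes of an infinite binary tree; $|\sigma|$ is the length of $\sigma$, and the two daughters of $\sigma$ are $\sigma 0$ and $\sigma 1$. A Bing tree of functions consists of, for every finite binary string $\sigma$, a function $f_\sigma : [c_\sigma, d_\sigma] \to [0,1]$ on a closed interval of $\mathbb{R}$, together with two distinct points $a_\sigma, b_\sigma$ (the daughter clasp points) satisfying $c_\sigma \le a_\sigma < b_\sigma \le d_\sigma$, such that: - $f_\varnothing : [0,1]\to[0,1]$ is the identity (so $c_\varnothing = 0$, $d_\varnothing = 1$); - for every $\sigma$, writing $a,b,c,d$ for $a_\sigma,b_\sigma,c_\sigma,d_\sigma$, the daughter functions are determined by $f_\sigma$ and $a,b$ as follows: $f_{\sigma 0} : [2c-a,\, b] \to [0,1]$ (that is, $c_{\sigma 0} = 2c-a$ and $d_{\sigma 0} = b$), with $f_{\sigma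 0}(x) = f_\sigma(-x+2c)$ for $2c-a \le x \le c$ and $f_{\sigma 0}(x) = f_\sigma(x)$ for $c \le x \le b$; $f_{\sigma 1} : [a,\, 2d-b] \to [0,1]$ (that is, $c_{\sigma 1} = a$ and $d_{\sigma 1} = 2d-b$), with $f_{\sigma 1}(x) = f_\sigma(x)$ for $a \le x \le d$ and $f_{\sigma 1}(x) = f_\sigma(-x+2d)$ for $d \le x \le 2d-b$. The choice of the points $a_\sigma, b_\sigma$ is otherwise free and determines the whole tree. A Bing tree of functions $\{f_\sigma\}$ shrinks if $\operatorname{diam}(\operatorname{im}(f_\sigma)) \to 0$ as $|\sigma| \to \infty$, i.e. for every $\delta > 0$ there is $N$ such that $\operatorname{diam}(\operatorname{im}(f_\sigma)) < \delta$ for all $\sigma$ with $|\sigma| \ge N$. *)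

(* Defs.v *)
From Stdlib Require Import Reals List.
From Coquelicot Require Import Coquelicot.
Import ListNotations.
Open Scope R_scope.

(** A finite binary string is a [list bool], read from left to right, with
    [false] for the digit 0 and [true] for the digit 1, so the daughters of
    [s] are [s ++ [false]] and [s ++ [true]]. *)

(** The function at node [s] is a total function [R -> R] of which only the
    restriction to [[lend s, rend s]] is meaningful: nothing is required of its
    values elsewhere, and every notion below looks only at that interval. *)
Record bing_tree : Type := {
  fn : list bool -> R -> R;
  lend : list bool -> R;      (* c *)
  rend : list bool -> R;      (* d *)
  lclasp : list bool -> R;    (* a *)
  rclasp : list bool -> R;    (* b *)

  clasps_in_domain : forall s,
    lend s <= lclasp s /\ lclasp s < rclasp s /\ rclasp s <= rend s;
  fn_in_unit : forall s x,
    lend s <= x <= rend s -> 0 <= fn s x <= 1;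

  lend_root : lend [] = 0;
  rend_root : rend [] = 1;
  fn_root : forall x, 0 <= x <= 1 -> fn [] x = x;

  lend_daughter0 : forall s, lend (s ++ [false]) = 2 * lend s - lclasp s;
  rend_daughter0 : forall s, rend (s ++ [false]) = rclasp s;
  fn_daughter0_fold : forall s x,
    2 * lend s - lclasp s <= x <= lend s ->
    fn (s ++ [false]) x = fn s (- x + 2 * lend s);
  fn_daughter0_keep : forall s x,
    lend s <= x <= rclasp s ->
    fn (s ++ [false]) x = fn s x;

  lend_daughter1 : forall s, lend (s ++ [true]) = lclasp s;
  rend_daughter1 : forall s, rend (s ++ [true]) = 2 * rend s - rclasp s;
  fn_daughter1_keep : forall s x,
    lclasp s <= x <= rend s ->
    fn (s ++ [true]) x = fn s x;
  fn_daughter1_fold : forall s x,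
    rend s <= x <= 2 * rend s - rclasp s ->
    fn (s ++ [true]) x = fn s (- x + 2 * rend s)
}.

Definition im (T : bing_tree) (s : list bool) : R -> Prop :=
  fun y => exists x, lend T s <= x <= rend T s /\ y = fn T s x.

Definition diam (E : R -> Prop) : Rbar :=
  Lub_Rbar (fun r => exists u v, E u /\ E v /\ r = Rabs (u - v)).

Definition shrinks (T : bing_tree) : Prop :=
  forall delta : R, 0 < delta ->
  exists N : nat, forall s : list bool,
    (N <= length s)%nat -> Rbar_lt (diam (im T s)) delta.

(* Main.v *)
Require Import Defs.
From Stdlib Require Import Reals List.
From Coquelicot Require Import Coquelicot.
From Stdlib Require Import Lra Lia.
Import ListNotations.
Open Scope R_scope.

(** Only the endpoints matter: with offsets [x = a - c] and [y = d - b], the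
    daughters of the window [(c, d)] are [(c - x, d - y)] and
    [(c + x, d + y)], and each daughter function is the mother composed with a
    folding map, so images only shrink.  Let [(c0, d0)] be the window at the
    start of a phase, [u] the largest left and [v] the smallest right endpoint
    seen since then.  If the offsets of the phase are at most [m], everything
    outside [[u, v]] is mapped within [m] of [f u] or [f v]; hence the image
    has diameter at most [v - u + 2 m], and it suffices to make [v - u] small.

    To achieve this, view [(c, d)] as a point of the plane and move it
    orthogonally to the segment joining it to a far away centre
    [(c0 - K, d0 + K)]; such a move has offsets of the right sign.  By
    Pythagoras the squared distance to the centre grows by [x^2 + y^2]
    whichever daughter is taken, so that the length [d - c] exceeds its initial
    value by at most a multiple of [1 / K].  As long as [u <= v] the point stays
    in a bounded region, so the divergence of the sum of squares ends the phase
    after a number of steps that is the same for all branches.  Successive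
    phases use targets for [v - u], offset bounds and values of [1 / K] that
    decrease geometrically. *)

(** * Scales, states and moves of a window *)

Section Steering.

Variable theta : R.
Hypothesis theta_bounds : 0 < theta <= / 2.

(** In phase [k] this is the target width of the core and also the allowed growth of the window
    length; the growths of all phases sum to [2 * theta]. *)
Definition scale (k : nat) : R := theta * (/ 2) ^ k.

Lemma pow_half_bounds (k : nat) : 0 < (/ 2) ^ k <= 1.
Proof. induction k as [|k IH]; simpl; lra. Qed.

Lemma scale_bounds (k : nat) : 0 < scale k <= / 2.
Proof. unfold scale; assert (H := pow_half_bounds k); split; nra. Qed.

Lemma scale_S (k : nat) : scale (S k) = scale k / 2.
Proof. unfold scale; simpl; lra. Qed.

Record state : Type := State {
  phase : nat;
  left_end : R;
  right_end : R;
  start_left : R;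
  start_right : R;
  core_left : R;
  core_right : R;
  func : R -> R
}.

(* [1 / (2 K)], where [K] is the distance of the centre in each coordinate. *)
Definition curvature (S : state) : R := scale (phase S) / 18.
Definition left_shift (S : state) : R := left_end S - start_left S.
Definition right_shift (S : state) : R := right_end S - start_right S.

(** The cap keeps a single step short compared with the width of the core. The offsets below are
    [stride / (2 K)] times [(K - right_shift, K + left_shift)], which is orthogonal to the vector
    [(K + left_shift, right_shift - K)] from the centre to the current point. *)
Definition stride (e : R) (S : state) : R := Rmin e (scale (phase S) / 8).
Definition left_offset (e : R) (S : state) : R :=
  stride e S * (/ 2 - curvature S * right_shift S).
Definition right_offset (e : R) (S : state) : R :=
  stride e S * (/ 2 + curvature S * left_shift S).

(* [(dist^2 - 2 K^2) / (2 K)], where [dist] is the distance to the centre. *)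
Definition energy (S : state) : R :=
  left_shift S - right_shift S
  + curvature S * (left_shift S ^ 2 + right_shift S ^ 2).

(** One absolute value covers the kept and the reflected piece of a daughter together, which makes
    the 1-Lipschitz property immediate. *)
Definition fold_map (b : bool) (c d x : R) : R :=
  if b then d - Rabs (d - x) else c + Rabs (x - c).

Definition next_left (e : R) (b : bool) (S : state) : R :=
  if b then left_end S + left_offset e S else left_end S - left_offset e S.
Definition next_right (e : R) (b : bool) (S : state) : R :=
  if b then right_end S + right_offset e S else right_end S - right_offset e S.
Definition next_func (b : bool) (S : state) (x : R) : R :=
  func S (fold_map b (left_end S) (right_end S) x).

Definition next_core_left (e : R) (b : bool) (S : state) : R :=
  Rmax (core_left S) (next_left e b S).
Definition next_core_right (e : R) (b : bool) (S : state) : R :=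
  Rmin (core_right S) (next_right e b S).

Definition start_phase (k : nat) (c d : R) (f : R -> R) : state :=
  State k c d c d c d f.

Definition continue_phase (e : R) (b : bool) (S : state) : state :=
  State (phase S) (next_left e b S) (next_right e b S)
        (start_left S) (start_right S)
        (next_core_left e b S) (next_core_right e b S) (next_func b S).

Definition next (e : R) (b : bool) (S : state) : state :=
  if Rlt_dec (next_core_right e b S - next_core_left e b S) (scale (phase S))
  then start_phase (Datatypes.S (phase S)) (next_left e b S) (next_right e b S)
                   (next_func b S)
  else continue_phase e b S.

(** The core lies in both the current and the initial window of the phase. In [start_length], the
    excess [2 * theta - 2 * scale k] is the sum of the growths allowed to the phases before [k]. *)
Record position_ok (S : state) : Prop := {
  left_le_core : left_end S <= core_left S;
  core_le_right : core_right S <= right_end S;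
  start_le_core : start_left S <= core_left S;
  core_le_start : core_right S <= start_right S;
  core_wide : scale (phase S) <= core_right S - core_left S;
  start_length :
    start_right S - start_left S <= 1 + 2 * theta - 2 * scale (phase S);
  length_growth :
    right_end S - left_end S <= start_right S - start_left S + scale (phase S);
  energy_nonneg : 0 <= energy S
}.

(** The two [near] bounds concern the running core and yield a new diameter bound only when the
    phase ends; during a phase, [func_diameter] is inherited from its start. *)
Record function_ok (S : state) : Prop := {
  func_unit : forall x, left_end S <= x <= right_end S -> 0 <= func S x <= 1;
  func_lipschitz : forall x y,
    left_end S <= x <= right_end S -> left_end S <= y <= right_end S ->
    Rabs (func S x - func S y) <= Rabs (x - y);
  func_near_left : forall x, left_end S <= x <= core_left S ->
    Rabs (func S x - func S (core_left S)) <= scale (phase S) / 8;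
  func_near_right : forall x, core_right S <= x <= right_end S ->
    Rabs (func S x - func S (core_right S)) <= scale (phase S) / 8;
  func_diameter : forall x y,
    left_end S <= x <= right_end S -> left_end S <= y <= right_end S ->
    Rabs (func S x - func S y) <= 4 * (/ 2) ^ phase S
}.

(** * Bounds on positions, offsets and energy *)

Lemma length_bound (S : state) :
  position_ok S -> right_end S - left_end S <= 1 + 2 * theta - scale (phase S).
Proof. intros [_ _ _ _ _ H1 H2 _]; lra. Qed.

(** The current and the initial window both contain the core, hence overlap, and both have length at
    most 2. *)
Lemma shift_bounds (S : state) :
  position_ok S -> -2 <= left_shift S <= 2 /\ -2 <= right_shift S <= 2.
Proof.
  intros [H1 H2 H3 H4 H5 H6 H7 _].
  assert (Hs := scale_bounds (phase S)).
  unfold left_shift, right_shift; lra.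
Qed.

Lemma curvature_bounds (S : state) : 0 < curvature S <= / 36.
Proof. unfold curvature; assert (H := scale_bounds (phase S)); lra. Qed.

Lemma stride_bounds (e : R) (S : state) :
  0 <= e -> 0 <= stride e S <= scale (phase S) / 8 /\ stride e S <= e.
Proof.
  intros He; unfold stride; assert (H := scale_bounds (phase S)).
  split; [split|].
  - apply Rmin_glb; lra.
  - apply Rmin_r.
  - apply Rmin_l.
Qed.

(** Curvature times shift is at most [2 / 36], so both factors of the stride lie within [1 / 18] of
    [1 / 2]; in particular the offsets have the right sign. *)
Lemma offset_bounds (e : R) (S : state) :
  0 <= e -> position_ok S ->
  4 / 9 * stride e S <= left_offset e S <= 5 / 9 * stride e S /\
  4 / 9 * stride e S <= right_offset e S <= 5 / 9 * stride e S.
Proof.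
  intros He HS.
  destruct (shift_bounds S HS) as [Hl Hr].
  assert (Hk := curvature_bounds S).
  destruct (stride_bounds e S He) as [Ht _].
  unfold left_offset, right_offset.
  assert (-/18 <= curvature S * left_shift S <= /18) by (split; nra).
  assert (-/18 <= curvature S * right_shift S <= /18) by (split; nra).
  repeat split; nra.
Qed.

Lemma energy_continue (e : R) (b : bool) (S : state) :
  energy (continue_phase e b S) =
  energy S + curvature S * (left_offset e S ^ 2 + right_offset e S ^ 2).
Proof.
  unfold energy, left_shift, right_shift, curvature, continue_phase,
    next_left, next_right; simpl.
  (* Orthogonality: the first-order change of the energy vanishes, whichever daughter is taken. *)
  assert (Ho : left_offset e S - right_offset e S =
    - 2 * curvature S *
      (left_shift S * left_offset e S + right_shift S * right_offset e S)).
  { unfold left_offset, right_offset; field. }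
  unfold left_shift, right_shift, curvature in Ho.
  destruct b; nra.
Qed.

Lemma energy_gain (e : R) (b : bool) (S : state) :
  0 <= e -> position_ok S ->
  energy S + curvature S * (stride e S ^ 2 / 3) <= energy (continue_phase e b S).
Proof.
  intros He HS; rewrite energy_continue.
  destruct (offset_bounds e S He HS) as [Hl Hr].
  destruct (stride_bounds e S He) as [Ht _].
  assert (Hk := curvature_bounds S).
  apply Rplus_le_compat_l, Rmult_le_compat_l; [lra | nra].
Qed.

Lemma energy_le (S : state) : position_ok S -> energy S <= 5.
Proof.
  intros HS.
  destruct (shift_bounds S HS) as [Hl Hr].
  assert (Hk := curvature_bounds S).
  unfold energy.
  assert (left_shift S ^ 2 + right_shift S ^ 2 <= 8) by nra.
  assert (0 <= left_shift S ^ 2 + right_shift S ^ 2) by nra.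
  nra.
Qed.

(** Each core end moves by at most [5 / 9] of an eighth of the scale. Hence the core is still
    nonempty when a phase ends, and the new window is wide enough for the halved scale. *)
Lemma next_core_wide (e : R) (b : bool) (S : state) :
  0 <= e -> position_ok S ->
  scale (phase S) * 3 / 4 <= next_core_right e b S - next_core_left e b S.
Proof.
  intros He HS.
  destruct (offset_bounds e S He HS) as [Hl Hr].
  destruct (stride_bounds e S He) as [Ht _].
  destruct HS as [H1 H2 _ _ H5 _ _ _].
  unfold next_core_left, next_core_right, next_left, next_right.
  destruct b; apply Rmax_case; apply Rmin_case; lra.
Qed.

(** Nonnegative energy bounds the growth by the curvature times the sum of the squared shifts. The
    bound is proved for the move itself, so it also holds for a move that ends the phase. *)
Lemma next_length_growth (e : R) (b : bool) (S : state) :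
  0 <= e -> position_ok S ->
  next_right e b S - next_left e b S
  <= start_right S - start_left S + scale (phase S).
Proof.
  intros He HS.
  assert (HE := energy_gain e b S He HS).
  assert (Hk := curvature_bounds S).
  destruct (offset_bounds e S He HS) as [Hl Hr].
  destruct (stride_bounds e S He) as [Ht _].
  assert (Hs := scale_bounds (phase S)).
  destruct (shift_bounds S HS) as [Hal Har].
  destruct HS as [_ _ _ _ _ _ _ H8].
  assert (Hpos : 0 <= energy (continue_phase e b S)).
  { assert (0 <= curvature S * (stride e S ^ 2 / 3)).
    { apply Rmult_le_pos; [lra | nra]. }
    lra. }
  unfold energy, curvature, left_shift, right_shift in Hpos; simpl in Hpos.
  unfold left_shift in Hal; unfold right_shift in Har.
  (* Shifts of at most 2 before the move stay below 3 after it; the squares then sum to at most 18,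
     the divisor in [curvature]. *)
  assert (-3 <= next_left e b S - start_left S <= 3)
    by (unfold next_left; destruct b; lra).
  assert (-3 <= next_right e b S - start_right S <= 3)
    by (unfold next_right; destruct b; lra).
  assert ((next_left e b S - start_left S) ^ 2
          + (next_right e b S - start_right S) ^ 2 <= 18) by nra.
  nra.
Qed.

Lemma energy_start (k : nat) (c d : R) (f : R -> R) :
  energy (start_phase k c d f) = 0.
Proof. unfold energy, left_shift, right_shift; simpl; ring. Qed.

Lemma position_next (e : R) (b : bool) (S : state) :
  0 <= e -> position_ok S -> position_ok (next e b S).
Proof.
  intros He HS.
  assert (Hw := next_core_wide e b S He HS).
  assert (Hg := next_length_growth e b S He HS).
  assert (Hs := scale_bounds (phase S)).
  assert (Hl : next_left e b S <= next_core_left e b S) by apply Rmax_r.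
  assert (Hr : next_core_right e b S <= next_right e b S) by apply Rmin_r.
  unfold next; destruct Rlt_dec as [Hlt|Hge].
  - destruct HS as [_ _ _ _ _ H6 _ _].
    constructor; try (rewrite energy_start; lra);
      simpl; rewrite ?scale_S; lra.
  - assert (HE := energy_gain e b S He HS).
    assert (Hk := curvature_bounds S).
    destruct HS as [_ _ H3 H4 _ H6 _ H8].
    assert (core_left S <= next_core_left e b S) by apply Rmax_l.
    assert (next_core_right e b S <= core_right S) by apply Rmin_l.
    constructor; try (simpl; lra).
    assert (0 <= curvature S * (stride e S ^ 2 / 3))
      by (apply Rmult_le_pos; [lra | nra]).
    lra.
Qed.

(** * Folding and the size of images *)

Lemma fold_map_lipschitz (b : bool) (c d x y : R) :
  Rabs (fold_map b c d x - fold_map b c d y) <= Rabs (x - y).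
Proof.
  unfold fold_map; destruct b; unfold Rabs; repeat destruct Rcase_abs; lra.
Qed.

Lemma fold_map_range (e : R) (b : bool) (S : state) (x : R) :
  0 <= e -> position_ok S ->
  next_left e b S <= x <= next_right e b S ->
  left_end S <= fold_map b (left_end S) (right_end S) x <= right_end S.
Proof.
  intros He HS Hx.
  destruct (offset_bounds e S He HS) as [Hl Hr].
  destruct (stride_bounds e S He) as [Ht _].
  destruct HS as [H1 H2 _ _ H5 _ _ _].
  unfold next_left, next_right in Hx; unfold fold_map.
  destruct b; unfold Rabs; destruct Rcase_abs; lra.
Qed.

(** If the new left end overtakes the core, the interval is a point. Otherwise [core_left] is
    unchanged and is fixed by the folding map, so it remains to locate the folded [x]. *)
Lemma next_near_left (e : R) (b : bool) (S : state) (x : R) :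
  0 <= e -> position_ok S -> function_ok S ->
  next_left e b S <= x <= next_core_left e b S ->
  Rabs (next_func b S x - next_func b S (next_core_left e b S))
  <= scale (phase S) / 8.
Proof.
  intros He HS HF Hx.
  destruct (offset_bounds e S He HS) as [Hl Hr].
  destruct (stride_bounds e S He) as [Ht _].
  destruct HS as [H1 H2 _ _ H5 _ _ _].
  assert (Hs := scale_bounds (phase S)).
  unfold next_core_left in *; revert Hx.
  apply Rmax_case_strong; intros Hm Hx.
  2: { replace x with (next_left e b S) by lra.
       rewrite Rminus_diag_eq, Rabs_R0; [lra | reflexivity]. }
  unfold next_left in Hx; unfold next_func, fold_map; destruct b.
  - rewrite (Rabs_pos_eq (right_end S - x)),
      (Rabs_pos_eq (right_end S - core_left S))
      by lra.
    replace (right_end S - (right_end S - x)) with x by ring.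
    replace (right_end S - (right_end S - core_left S))
      with (core_left S) by ring.
    apply (func_near_left S HF); lra.
  - rewrite (Rabs_pos_eq (core_left S - left_end S)) by lra.
    replace (left_end S + (core_left S - left_end S))
      with (core_left S) by ring.
    assert (Hz : left_end S <= left_end S + Rabs (x - left_end S)
                 <= core_left S + scale (phase S) / 8).
    { unfold Rabs; destruct Rcase_abs; lra. }
    destruct (Rle_dec (left_end S + Rabs (x - left_end S)) (core_left S)).
    + apply (func_near_left S HF); lra.
    (* The reflected piece passes [core_left] by at most one offset, which the Lipschitz bound
       absorbs. *)
    + eapply Rle_trans; [apply (func_lipschitz S HF); lra |].
      rewrite Rabs_pos_eq; lra.
Qed.

Lemma next_near_right (e : R) (b : bool) (S : state) (x : R) :
  0 <= e -> position_ok S -> function_ok S ->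
  next_core_right e b S <= x <= next_right e b S ->
  Rabs (next_func b S x - next_func b S (next_core_right e b S))
  <= scale (phase S) / 8.
Proof.
  intros He HS HF Hx.
  destruct (offset_bounds e S He HS) as [Hl Hr].
  destruct (stride_bounds e S He) as [Ht _].
  destruct HS as [H1 H2 _ _ H5 _ _ _].
  assert (Hs := scale_bounds (phase S)).
  unfold next_core_right in *; revert Hx.
  apply Rmin_case_strong; intros Hm Hx.
  2: { replace x with (next_right e b S) by lra.
       rewrite Rminus_diag_eq, Rabs_R0; [lra | reflexivity]. }
  unfold next_right in Hx; unfold next_func, fold_map; destruct b.
  - rewrite (Rabs_pos_eq (right_end S - core_right S)) by lra.
    replace (right_end S - (right_end S - core_right S))
      with (core_right S) by ring.
    assert (Hz : core_right S - scale (phase S) / 8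
                 <= right_end S - Rabs (right_end S - x) <= right_end S).
    { unfold Rabs; destruct Rcase_abs; lra. }
    destruct (Rle_dec (core_right S) (right_end S - Rabs (right_end S - x))).
    + apply (func_near_right S HF); lra.
    + eapply Rle_trans; [apply (func_lipschitz S HF); lra |].
      rewrite Rabs_left1; lra.
  - rewrite (Rabs_pos_eq (x - left_end S)),
      (Rabs_pos_eq (core_right S - left_end S))
      by lra.
    replace (left_end S + (x - left_end S)) with x by ring.
    replace (left_end S + (core_right S - left_end S))
      with (core_right S) by ring.
    apply (func_near_right S HF); lra.
Qed.

(** Each point is replaced, at cost [m], by its nearest point of [[u, v]], where the Lipschitz bound
    applies. *)
Lemma diameter_core (f : R -> R) (c d u v m : R) :
  0 <= m -> c <= u -> u <= v -> v <= d ->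
  (forall x y, c <= x <= d -> c <= y <= d -> Rabs (f x - f y) <= Rabs (x - y)) ->
  (forall x, c <= x <= u -> Rabs (f x - f u) <= m) ->
  (forall x, v <= x <= d -> Rabs (f x - f v) <= m) ->
  forall x y, c <= x <= d -> c <= y <= d ->
  Rabs (f x - f y) <= v - u + 2 * m.
Proof.
  intros Hm Hcu Huv Hvd Hlip Hl Hr x y Hx Hy.
  assert (Hcore : forall z, c <= z <= d ->
    exists w, u <= w <= v /\ Rabs (f z - f w) <= m).
  { intros z Hz.
    destruct (Rle_dec z u); [exists u; split; [lra | apply Hl; lra] |].
    destruct (Rle_dec v z); [exists v; split; [lra | apply Hr; lra] |].
    exists z; split; [lra |].
    rewrite Rminus_diag_eq, Rabs_R0; [lra | reflexivity]. }
  destruct (Hcore x Hx) as [w [Hw Hxw]].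
  destruct (Hcore y Hy) as [w' [Hw' Hyw]].
  assert (Hww : Rabs (f w - f w') <= v - u).
  { eapply Rle_trans; [apply Hlip; lra |].
    unfold Rabs; destruct Rcase_abs; lra. }
  revert Hxw Hyw Hww; unfold Rabs; repeat destruct Rcase_abs; lra.
Qed.

Lemma function_next (e : R) (b : bool) (S : state) :
  0 <= e -> position_ok S -> function_ok S -> function_ok (next e b S).
Proof.
  intros He HS HF.
  assert (Hs := scale_bounds (phase S)).
  assert (Hrange := fold_map_range e b S).
  assert (Hunit : forall x, next_left e b S <= x <= next_right e b S ->
    0 <= next_func b S x <= 1) by (intros; apply (func_unit S HF); auto).
  assert (Hlip : forall x y,
    next_left e b S <= x <= next_right e b S ->
    next_left e b S <= y <= next_right e b S ->
    Rabs (next_func b S x - next_func b S y) <= Rabs (x - y)).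
  { intros x y Hx Hy.
    eapply Rle_trans; [apply (func_lipschitz S HF); auto |].
    apply fold_map_lipschitz. }
  assert (Hnl := next_near_left e b S).
  assert (Hnr := next_near_right e b S).
  unfold next; destruct Rlt_dec as [Hlt|Hge].
  - assert (Hs' := scale_bounds (Datatypes.S (phase S))).
    constructor; simpl; auto.
    + intros x Hx; replace x with (next_left e b S) by lra.
      rewrite Rminus_diag_eq, Rabs_R0; [lra | reflexivity].
    + intros x Hx; replace x with (next_right e b S) by lra.
      rewrite Rminus_diag_eq, Rabs_R0; [lra | reflexivity].
    + intros x y Hx Hy.
      assert (Hw := next_core_wide e b S He HS).
      eapply Rle_trans.
      { apply (diameter_core (next_func b S)
          (next_left e b S) (next_right e b S)
          (next_core_left e b S) (next_core_right e b S) (scale (phase S) / 8));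
          auto; try lra; [apply Rmax_r | apply Rmin_r]. }
      (* The diameter is at most [5 / 4 * scale k], well below [4 * (/ 2) ^ (k + 1)]. *)
      assert (Hp := pow_half_bounds (phase S)).
      unfold scale in *; nra.
  - constructor; simpl; auto.
    intros x y Hx Hy; apply (func_diameter S HF); auto.
Qed.

Lemma phase_next (e : R) (b : bool) (S : state) :
  0 <= e -> position_ok S ->
  phase (next e b S) = Datatypes.S (phase S) \/
  (phase (next e b S) = phase S /\
   energy S + curvature S * (stride e S ^ 2 / 3) <= energy (next e b S)).
Proof.
  intros He HS.
  assert (HE := energy_gain e b S He HS).
  unfold next; destruct Rlt_dec; [left; reflexivity | right; split; auto].
Qed.

(** * The tree generated by the moves *)

Section Tree.

Variable e : nat -> R.
Hypothesis e_nonneg : forall n, 0 <= e n.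

(** Daughters append a digit at the end, so the recursion runs on the reversed string; the move out
    of a node of length [n] uses [e n]. *)
Fixpoint rev_node (r : list bool) : state :=
  match r with
  | [] => start_phase 0 0 1 (fun x => x)
  | b :: r' => next (e (length r')) b (rev_node r')
  end.

Definition node (s : list bool) : state := rev_node (rev s).

Lemma node_app (s : list bool) (b : bool) :
  node (s ++ [b]) = next (e (length s)) b (node s).
Proof.
  unfold node; rewrite rev_app_distr; simpl; rewrite length_rev; reflexivity.
Qed.

Lemma node_ok (s : list bool) : position_ok (node s) /\ function_ok (node s).
Proof.
  induction s as [|b s [HP HF]] using rev_ind.
  - unfold node; simpl; split.
    + constructor; try (rewrite energy_start; lra);
        simpl; unfold scale; simpl; lra.
    + constructor; simpl; unfold scale; intros; simpl.
      * lra.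
      * lra.
      * replace x with 0 by lra; rewrite Rminus_0_r, Rabs_R0; lra.
      * replace x with 1 by lra; rewrite Rminus_diag, Rabs_R0; lra.
      * unfold Rabs; destruct Rcase_abs; lra.
  - rewrite node_app; split; [apply position_next | apply function_next]; auto.
Qed.

Definition node_lclasp (s : list bool) : R :=
  left_end (node s) + left_offset (e (length s)) (node s).
Definition node_rclasp (s : list bool) : R :=
  right_end (node s) - right_offset (e (length s)) (node s).

Lemma node_offset_bounds (s : list bool) :
  0 <= left_offset (e (length s)) (node s) <= e (length s) /\
  0 <= right_offset (e (length s)) (node s) <= e (length s).
Proof.
  destruct (node_ok s) as [HP _].
  destruct (offset_bounds _ _ (e_nonneg (length s)) HP) as [Hl Hr].
  destruct (stride_bounds _ (node s) (e_nonneg (length s))) as [Ht Ht'].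
  lra.
Qed.

Lemma node_clasps (s : list bool) :
  left_end (node s) <= node_lclasp s /\
  node_lclasp s < node_rclasp s /\
  node_rclasp s <= right_end (node s).
Proof.
  unfold node_lclasp, node_rclasp.
  destruct (node_ok s) as [HP _].
  destruct (offset_bounds _ _ (e_nonneg (length s)) HP) as [Hl Hr].
  destruct (stride_bounds _ (node s) (e_nonneg (length s))) as [Ht _].
  destruct HP as [H1 H2 _ _ H5 _ _ _].
  assert (Hs := scale_bounds (phase (node s))).
  lra.
Qed.

Lemma left_end_next (x : R) (b : bool) (S : state) :
  left_end (next x b S) = next_left x b S.
Proof. unfold next; destruct Rlt_dec; reflexivity. Qed.

Lemma right_end_next (x : R) (b : bool) (S : state) :
  right_end (next x b S) = next_right x b S.
Proof. unfold next; destruct Rlt_dec; reflexivity. Qed.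

Lemma func_next (x : R) (b : bool) (S : state) :
  func (next x b S) = next_func b S.
Proof. unfold next; destruct Rlt_dec; reflexivity. Qed.

Definition steered_tree : bing_tree.
Proof.
  refine {| fn := fun s => func (node s);
            lend := fun s => left_end (node s);
            rend := fun s => right_end (node s);
            lclasp := node_lclasp;
            rclasp := node_rclasp;
            clasps_in_domain := node_clasps |};
    try reflexivity;
    try (intros s; rewrite node_app, ?left_end_next, ?right_end_next;
         unfold next_left, next_right, node_lclasp, node_rclasp; ring).
  - intros s; apply func_unit, node_ok.
  - intros s x Hx; rewrite node_app, func_next; unfold next_func, fold_map.
    rewrite Rabs_left1 by lra; f_equal; ring.
  - intros s x Hx; rewrite node_app, func_next; unfold next_func, fold_map.
    rewrite Rabs_pos_eq by lra; f_equal; ring.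
  - intros s x Hx; rewrite node_app, func_next; unfold next_func, fold_map.
    rewrite Rabs_pos_eq by lra; f_equal; ring.
  - intros s x Hx; rewrite node_app, func_next; unfold next_func, fold_map.
    rewrite Rabs_left1 by lra; f_equal; ring.
Defined.

(** * Divergence ends every phase *)

Hypothesis e_diverges : forall m, 0 < m ->
  is_lim_seq (fun n => sum_n_m (fun i => Rmin (e i) m ^ 2) 1 n) p_infty.

(** Induction on the depth: a move either advances the phase or adds its energy gain. A node of
    length [S n] has behind it the moves with indices up to [n], hence the shift; at length [S N]
    nonnegativity of the energy suffices, wherever in the phase the node lies. *)
Lemma energy_total_gain (k N : nat) :
  (forall s, (N <= length s)%nat -> (k <= phase (node s))%nat) ->
  let W n := sum_n_m (fun i => Rmin (e i) (scale k / 8) ^ 2) 1 n in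
  forall n s, (N <= n)%nat -> length s = S n ->
  (S k <= phase (node s))%nat \/
  (phase (node s) = k /\ scale k / 54 * (W n - W N) <= energy (node s)).
Proof.
  intros Hk W n s Hn; revert s; induction Hn as [|n Hn IH]; intros s Hs.
  - assert (Hp := Hk s ltac:(lia)).
    destruct (node_ok s) as [HP _].
    assert (HE := energy_nonneg _ HP).
    destruct (Nat.eq_dec (phase (node s)) k);
      [right; split; [auto | lra] | left; lia].
  - destruct s as [|b s _] using rev_ind; [discriminate |].
    rewrite length_app in Hs; simpl in Hs.
    assert (Hs' : length s = S n) by lia.
    rewrite node_app.
    destruct (node_ok s) as [HP _].
    destruct (phase_next _ b _ (e_nonneg (length s)) HP) as [Hp | [Hp HE]];
      rewrite Hp; (destruct (IH s Hs') as [Hg | [Hq HE']]; [left; lia |]).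
    + left; lia.
    + right; split; [exact Hq |].
      assert (HW : W (S n) = W n + Rmin (e (S n)) (scale k / 8) ^ 2).
      { unfold W; rewrite sum_n_Sm by lia; reflexivity. }
      rewrite HW.
      unfold stride, curvature in HE; rewrite Hq, Hs' in HE.
      rewrite Hs'; lra.
Qed.

(** The threshold depends only on the sums of capped squares, so it is common to all branches. *)
Lemma phase_unbounded (k : nat) :
  exists N, forall s, (N <= length s)%nat -> (k <= phase (node s))%nat.
Proof.
  induction k as [|k [N HN]]; [exists O; intros; lia |].
  assert (Hs := scale_bounds k).
  set (W := fun n => sum_n_m (fun i => Rmin (e i) (scale k / 8) ^ 2) 1 n).
  assert (HW : is_lim_seq W p_infty) by (apply e_diverges; lra).
  apply is_lim_seq_spec in HW.
  (* Here 5 is the ceiling from [energy_le] and [scale k / 54] is the curvature over 3, so a branch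
     still in phase [k] beyond this depth would exceed the ceiling. *)
  destruct (HW (W N + 5 / (scale k / 54))) as [M HM].
  exists (S (Nat.max N M)); intros s Hlen.
  destruct (length s) as [|n] eqn:Hl; [lia |].
  destruct (energy_total_gain k N HN n s ltac:(lia) Hl) as [Hp | [_ HE]];
    [exact Hp |].
  destruct (node_ok s) as [HP _].
  assert (HE5 := energy_le _ HP).
  assert (HMn := HM n ltac:(lia)).
  fold W in HE.
  assert (Hc : scale k / 54 * (5 / (scale k / 54)) < scale k / 54 * (W n - W N)).
  { apply Rmult_lt_compat_l; lra. }
  replace (scale k / 54 * (5 / (scale k / 54))) with 5 in Hc by (field; lra).
  change (scale k / 54 * (W n - W N) <= energy (node s)) in HE.
  lra.
Qed.

Lemma steered_tree_shrinks : shrinks steered_tree.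
Proof.
  intros delta Hdelta.
  destruct (pow_lt_1_zero (/ 2) ltac:(rewrite Rabs_pos_eq; lra) (delta / 4)
              ltac:(lra)) as [k Hk].
  destruct (phase_unbounded k) as [N HN].
  exists N; intros s Hs.
  specialize (Hk _ (HN s Hs)).
  assert (Hp := pow_half_bounds (phase (node s))).
  rewrite Rabs_pos_eq in Hk by lra.
  apply (Rbar_le_lt_trans _ (4 * (/ 2) ^ phase (node s))); [| simpl; lra].
  apply (proj2 (Lub_Rbar_correct _)).
  intros r [y [z [[x [Hx ->]] [[x' [Hx' ->]] ->]]]].
  apply (func_diameter _ (proj2 (node_ok s))); assumption.
Qed.

End Tree.

End Steering.

(** * Divergence of capped sums of squares *)

(** Needed because [stride] caps the steps. If the capped sums converged, their terms would tend to
    0, the cap would eventually be inactive, and the two sums would differ by a constant from then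
    on. *)
Lemma capped_sum_diverges (f : nat -> R) (m : R) :
  0 < m ->
  (forall i, 0 <= f i) ->
  is_lim_seq (fun n => sum_n_m (fun i => f i ^ 2) 1 n) p_infty ->
  is_lim_seq (fun n => sum_n_m (fun i => Rmin (f i) m ^ 2) 1 n) p_infty.
Proof.
  intros Hm Hf Hlim.
  set (g := fun i => Rmin (f i) m ^ 2).
  set (W := (fun n => sum_n_m g 1 n) : nat -> R).
  assert (HWS : forall n, W (S n) = W n + g (S n)).
  { intros n; unfold W; rewrite sum_n_Sm by lia; reflexivity. }
  assert (Hg : forall i, 0 <= g i) by (intros i; apply pow2_ge_0).
  assert (Hex : ex_lim_seq W).
  { apply ex_lim_seq_incr; intros n; rewrite HWS; specialize (Hg (S n)); lra. }
  destruct Hex as [[l | |] HW]; [| exact HW |].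
  - exfalso.
    assert (Hg0 : is_lim_seq (fun n => g (S n)) 0).
    { apply (is_lim_seq_ext (fun n => W (S n) - W n)).
      { intros n; rewrite HWS; lra. }
      replace (Finite 0) with (Finite (l - l)) by (f_equal; ring).
      apply is_lim_seq_minus'; [apply is_lim_seq_incr_1 in HW; exact HW | exact HW]. }
    apply is_lim_seq_spec in Hg0.
    destruct (Hg0 (mkposreal (m ^ 2) (pow_lt _ 2 Hm))) as [N HN]; simpl in HN.
    (* A term smaller than [m ^ 2] is not capped. *)
    assert (Hfg : forall n, (N <= n)%nat -> f (S n) ^ 2 = g (S n)).
    { intros n Hn; specialize (HN n Hn); unfold g in *; revert HN.
      apply Rmin_case_strong; intros Hfm HN; [reflexivity |].
      rewrite Rminus_0_r, Rabs_pos_eq in HN by apply pow2_ge_0; simpl in HN; lra. }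
    set (V := (fun n => sum_n_m (fun i => f i ^ 2) 1 n) : nat -> R).
    assert (HVW : forall n, (N <= n)%nat -> V n = W n + (V N - W N)).
    { intros n Hn; induction Hn as [|n Hn IH]; [ring |].
      rewrite HWS, <- (Hfg n Hn).
      replace (V (S n)) with (V n + f (S n) ^ 2); [rewrite IH; ring |].
      unfold V; rewrite (sum_n_Sm _ 1 n) by lia; reflexivity. }
    assert (HV : is_lim_seq V (l + (V N - W N))).
    { apply (is_lim_seq_ext_loc (fun n => W n + (V N - W N))).
      - exists N; intros n Hn; symmetry; apply HVW, Hn.
      - apply is_lim_seq_plus'; [exact HW | apply is_lim_seq_const]. }
    apply is_lim_seq_unique in HV; apply is_lim_seq_unique in Hlim.
    fold V in Hlim; rewrite Hlim in HV; discriminate.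
  - exfalso.
    apply is_lim_seq_spec in HW; destruct (HW 0) as [N HN].
    assert (HW0 : forall n, 0 <= W n).
    { induction n as [|n IH].
      - unfold W; rewrite sum_n_m_zero by lia; apply Rle_refl.
      - rewrite HWS; specialize (Hg (S n)); lra. }
    specialize (HN N (Nat.le_refl N)); specialize (HW0 N); lra.
Qed.

(** * Choice of the parameters *)

Theorem theorem1 (epsL : R) (eps : nat -> R)
  (epsL_pos : 0 < epsL)
  (eps_pos : forall i : nat, (1 <= i)%nat -> 0 < eps i)
  (eps_sum : is_lim_seq (fun n : nat => sum_n_m (fun i : nat => eps i ^ 2) 1 n) p_infty) :
  exists T : bing_tree,
    shrinks T /\
    (forall s : list bool, Rabs (rend T s - lend T s) < 1 + epsL) /\
    (forall (i : nat) (s : list bool), (1 <= i)%nat -> length s = i ->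
      Rabs (lclasp T s - lend T s) < eps i /\
      Rabs (rend T s - rclasp T s) < eps i).
Proof.
  (* The total growth [2 * theta] must not exceed [epsL], and the minimum with 1 keeps all windows
     of length at most 2. *)
  set (theta := Rmin epsL 1 / 2).
  assert (Htheta : 0 < theta <= / 2).
  { unfold theta; split; [apply Rmin_case; lra |].
    assert (H := Rmin_r epsL 1); lra. }
  assert (HepsL : 2 * theta <= epsL).
  { unfold theta; assert (H := Rmin_l epsL 1); lra. }
  (* [eps 0] is unconstrained, possibly negative. *)
  set (e := fun i => match i with O => 0 | S _ => eps i / 2 end).
  assert (He : forall i, 0 <= e i).
  { intros [|i]; simpl; [lra | assert (H := eps_pos (S i) ltac:(lia)); lra]. }
  assert (Hdiv : forall m, 0 < m ->
    is_lim_seq (fun n => sum_n_m (fun i => Rmin (e i) m ^ 2) 1 n) p_infty).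
  { intros m Hm; apply capped_sum_diverges; auto.
    apply (is_lim_seq_ext
      (fun n => / 4 * sum_n_m (fun i => eps i ^ 2) 1 n)).
    - intros n.
      transitivity (sum_n_m (fun i => mult (/ 4) (eps i ^ 2)) 1 n).
      { symmetry; apply (sum_n_m_mult_l (/ 4) (fun i => eps i ^ 2)). }
      apply sum_n_m_ext_loc; intros [|i] Hi; [lia |].
      unfold e, mult; simpl; field.
    - apply is_lim_seq_scal_l with (a := / 4) in eps_sum.
      replace p_infty with (Rbar_mult (/ 4) p_infty); [exact eps_sum |].
      apply is_Rbar_mult_unique, is_Rbar_mult_sym.
      apply is_Rbar_mult_p_infty_pos; simpl; lra. }
  exists (steered_tree theta Htheta e He); split; [| split].
  - apply steered_tree_shrinks, Hdiv.
  - intros s; simpl.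
    destruct (node_ok theta Htheta e He s) as [HP _].
    assert (Hlen := length_bound theta _ HP).
    assert (Hs := scale_bounds theta Htheta (phase (node theta e s))).
    destruct HP as [H1 H2 _ _ H5 _ _ _].
    rewrite Rabs_pos_eq; lra.
  - intros i s Hi Hs; simpl.
    destruct (node_offset_bounds theta Htheta e He s) as [Hl Hr].
    (* Halving [eps] turns the weak offset bound into a strict one and only divides the sum of
       squares by 4. *)
    assert (Hei : e (length s) < eps i).
    { rewrite Hs; destruct i as [|i]; [lia |]; simpl.
      assert (H := eps_pos (S i) Hi); lra. }
    unfold node_lclasp, node_rclasp.
    split; rewrite Rabs_pos_eq; lra.
Qed.
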